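(* Let $\beta\in[0,\frac12)$, let $m$ be a positive integer, and let $\mathcal X$ be a finite (nonempty) domain. Let $\mathcal A$ be any active learning algorithm over $\mathcal X$ which gets as input a random labeled sample $S\sim\mathcal D^m$ (with hidden labels) and outputs $\hat h:\mathcal X\to\{0,1\}$. If $\mathcal A$ queries fewer than $|\mathcal X|/2$ labels from $S$, then there exists a distribution $\mathcal D$ over $\mathcal X\times\{0,1\}$ such that: - its marginal on $\mathcal X$ is uniform, and for each $x\in\mathcal X$, $\mathbb P[Y=1\mid X=x]\in\{\beta,1-\beta\}$; - $\mathbb E[\mathrm{err}(\hat h,\mathcal D)]\ge\frac14$.
   Context: An active learning algorithm receives the unlabeled points of $S$ and may interactively request the labels of points of $S$, each choice possibly depending on the labels observed so far; it may use internal randomness. $\mathrm{err}(h,\mathcal D)=\mathbb P_{(X,Y)\sim\mathcal D}[h(X)\ne Y]$. The expectation is over $S\sim\mathcal D^m$ and the randomness of $\mathcal A$. *)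

(* Defs.v *)
From mathcomp Require Import all_boot all_order all_algebra.
From mathcomp Require Import all_classical all_reals all_analysis.

Set Implicit Arguments.
Unset Strict Implicit.
Unset Printing Implicit Defensive.

Import Order.TTheory GRing.Theory Num.Theory.

Local Open Scope ring_scope.

(* A deterministic interactive strategy for a sample of size m whose unlabeled
   points are already known: either output a hypothesis, or request the label
   of the i-th sample point and continue according to the answer. *)
Inductive strategy (X : finType) (m : nat) : Type :=
  | Output of {ffun X -> bool}
  | Query of 'I_m & (bool -> strategy X m).

Section Interaction.
Variables (X : finType) (m : nat).

Fixpoint output (t : strategy X m) (y : 'I_m -> bool) : {ffun X -> bool} :=
  match t with
  | Output h => h
  | Query i k => output (k (y i)) y
  end.

(* Requests are for sample indices, so two sample points at the same x carry
   separate labels; asking again for a label already seen is not counted. *)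
Fixpoint queried (t : strategy X m) (y : 'I_m -> bool) : {set 'I_m} :=
  match t with
  | Output _ => finset.set0
  | Query i k => (i |: queried (k (y i)) y)%SET
  end.

Definition points (S : {ffun 'I_m -> X * bool}) : {ffun 'I_m -> X} :=
  [ffun i => (S i).1].

Definition labels (S : {ffun 'I_m -> X * bool}) : 'I_m -> bool :=
  fun i => (S i).2.

End Interaction.

(* The internal randomness is a seed w drawn from a probability space,
   independently of the sample. *)
Definition active_learner (Omega : Type) (X : finType) (m : nat) : Type :=
  Omega -> {ffun 'I_m -> X} -> strategy X m.

Section Learner.
Variables (Omega : Type) (X : finType) (m : nat).
Variable A : active_learner Omega X m.

Definition learned (S : {ffun 'I_m -> X * bool}) (w : Omega) :
  {ffun X -> bool} := output (A w (points S)) (labels S).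

Definition num_queries (S : {ffun 'I_m -> X * bool}) (w : Omega) : nat :=
  #|queried (A w (points S)) (labels S)|.

End Learner.

(* On every sample, the output is a random element of the finite (discrete)
   set of hypotheses. *)
Definition measurable_learner (d : measure_display) (Omega : measurableType d)
    (X : finType) (m : nat) (A : active_learner Omega X m) : Prop :=
  forall (S : {ffun 'I_m -> X * bool}) (h : {ffun X -> bool}),
    measurable [set w : Omega | learned A S w = h]%classic.

Section Distribution.
Variables (R : realType) (X : finType).
Implicit Type D : {ffun X * bool -> R}.

Definition is_distribution D : Prop :=
  (forall z, 0 <= D z) /\ \sum_z D z = 1.

Definition marginal D (x : X) : R := \sum_(y : bool) D (x, y).

Definition cond_prob_one D (x : X) : R := D (x, true) / marginal D x.

Definition err (h : {ffun X -> bool}) D : R :=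
  \sum_(z : X * bool | h z.1 != z.2) D z.

Definition sample_prob (m : nat) D (S : {ffun 'I_m -> X * bool}) : R :=
  \prod_(i < m) D (S i).

End Distribution.

Definition expected_err (R : realType) (d : measure_display)
    (Omega : measurableType d) (P : probability Omega R) (X : finType)
    (m : nat) (A : active_learner Omega X m) (D : {ffun X * bool -> R}) :
    \bar R :=
  (\sum_(S : {ffun 'I_m -> X * bool})
     (sample_prob D S)%:E * 'E_P[fun w => err (learned A S w) D])%E.

(* Main.v *)
(** Draw the Bayes labelling [c : X -> bool] uniformly at random.  Flipping
    both [c] and all the sample labels at a fixed point [x] preserves the joint
    law of [c] and the sample; as long as [x] is not queried it also preserves
    the output hypothesis.  Hence the output is as likely to agree as to
    disagree with [c] at an unqueried [x], where the mean error is thus 1/2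
    whatever [beta] is.  More than half of the points are never queried, so the
    error averaged over [c] is at least 1/4, and some [c] does at least as badly
    as the average. *)
Require Import Defs.
From mathcomp Require Import all_boot all_order all_algebra.
From mathcomp Require Import all_classical all_reals all_analysis.
From mathcomp Require Import measurable_realfun ring lra.

Set Implicit Arguments.
Unset Strict Implicit.
Unset Printing Implicit Defensive.

Import Order.TTheory GRing.Theory Num.Theory.

Local Open Scope ring_scope.

(** A run sees [y] only at the indices it requests, so both runs get the same answer at each node
    and descend the same branch. *)
Lemma output_queried_agree (X : finType) (m : nat) (t : strategy X m)
    (y y' : 'I_m -> bool) :
  {in queried t y, y =1 y'} ->
  output t y' = output t y /\ queried t y' = queried t y.
Proof.
elim: t => [h|i k IH] //= yy'.
have yi : y i = y' i by apply: yy'; rewrite !inE eqxx.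
rewrite -yi; have [|-> -> //] := IH (y i).
by move=> j jq; apply: yy'; rewrite !inE jq orbT.
Qed.

(** * Flipping all labels at one point *)

Section Flip.
Context {X : finType} {m : nat}.

Definition flip_labelling (x : X) (c : {ffun X -> bool}) : {ffun X -> bool} :=
  [ffun x' => c x' (+) (x' == x)].

Definition flip_sample (x : X) (S : {ffun 'I_m -> X * bool}) :
    {ffun 'I_m -> X * bool} :=
  [ffun i => ((S i).1, (S i).2 (+) ((S i).1 == x))].

Definition flip (x : X)
    (p : {ffun X -> bool} * {ffun 'I_m -> X * bool}) :=
  (flip_labelling x p.1, flip_sample x p.2).

Lemma flipK (x : X) : involutive (flip x).
Proof.
move=> [c S]; congr pair; apply/ffunP => i; rewrite !ffunE /= addbK //.
by rewrite -surjective_pairing.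
Qed.

Lemma points_flip_sample (x : X) (S : {ffun 'I_m -> X * bool}) :
  points (flip_sample x S) = points S.
Proof. by apply/ffunP => i; rewrite !ffunE. Qed.

Definition queried_points (T : {ffun 'I_m -> X} -> strategy X m)
    (S : {ffun 'I_m -> X * bool}) : {set X} :=
  [set (S i).1 | i in queried (T (points S)) (labels S)].

(** No requested index sits at [x], so the flip alters only labels that the run never sees. *)
Lemma flip_sample_unqueried (T : {ffun 'I_m -> X} -> strategy X m) (x : X)
    (S : {ffun 'I_m -> X * bool}) :
  x \notin queried_points T S ->
  output (T (points (flip_sample x S))) (labels (flip_sample x S)) =
    output (T (points S)) (labels S) /\
  queried_points T (flip_sample x S) = queried_points T S.
Proof.
move=> xS; rewrite /queried_points points_flip_sample.
have [|-> ->] := @output_queried_agree X m (T (points S)) (labels S)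
  (labels (flip_sample x S)).
  move=> i iq; rewrite /labels ffunE /=.
  case: eqP => [Six|_]; last by rewrite addbF.
  by case/negP: xS; apply/imsetP; exists i.
by split=> //; apply: eq_imset => i; rewrite ffunE.
Qed.

(** Makes the event that [x] is unqueried stable under the flip, so that sums over it can be
    reindexed. *)
Lemma unqueried_flip (T : {ffun 'I_m -> X} -> strategy X m) (x : X)
    (S : {ffun 'I_m -> X * bool}) :
  (x \in queried_points T (flip_sample x S)) = (x \in queried_points T S).
Proof.
have notin S' : x \notin queried_points T S' ->
    x \notin queried_points T (flip_sample x S').
  by move=> /[dup] xS' /flip_sample_unqueried[_ ->].
apply/idP/idP; apply: contraTT; first exact: notin.
(* The converse flips twice. [flipK] concerns pairs, hence the dummy labelling. *)
by move/notin; have [_ ->] := flipK x ([ffun=> true], S).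
Qed.

End Flip.

(** * Noisy labellings and their average error *)

Section NoisyLabelling.
Context {R : realType} {X : finType}.
Variable beta : R.

(** A uniform point gets its label from [c], corrupted with probability [beta]. *)
Definition noisy_labelling (c : {ffun X -> bool}) : {ffun X * bool -> R} :=
  [ffun z => (if z.2 == c z.1 then 1 - beta else beta) / #|X|%:R].

Lemma noisy_labelling_flip (x : X) (c : {ffun X -> bool}) (z : X * bool) :
  noisy_labelling (flip_labelling x c) (z.1, z.2 (+) (z.1 == x)) =
  noisy_labelling c z.
Proof. by rewrite !ffunE /= (inj_eq (@addIb _)). Qed.

Lemma sample_prob_flip (m : nat) (x : X)
    (p : {ffun X -> bool} * {ffun 'I_m -> X * bool}) :
  sample_prob (noisy_labelling (flip x p).1) (flip x p).2 =
  sample_prob (noisy_labelling p.1) p.2.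
Proof.
by apply: eq_bigr => i _; rewrite /flip [flip_sample _ _ _]ffunE
  noisy_labelling_flip.
Qed.

Lemma marginal_noisy_labelling (c : {ffun X -> bool}) (x : X) :
  marginal (noisy_labelling c) x = 1 / #|X|%:R.
Proof.
by rewrite /marginal big_bool !ffunE /= -mulrDl; case: (c x) => /=;
  congr (_ / _); ring.
Qed.

Lemma cond_prob_one_noisy_labelling (c : {ffun X -> bool}) (x : X) :
  cond_prob_one (noisy_labelling c) x = if c x then 1 - beta else beta.
Proof.
have X0 : #|X|%:R != 0 :> R.
  by rewrite pnatr_eq0 -lt0n; apply/card_gt0P; exists x.
by rewrite /cond_prob_one marginal_noisy_labelling ffunE /= div1r invrK divfK.
Qed.

(** Splits the error by points, so that each summand can be treated with the flip at its own
    point. *)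
Lemma err_sum_points (h : {ffun X -> bool}) (D : {ffun X * bool -> R}) :
  err h D = \sum_x D (x, ~~ h x).
Proof.
rewrite /err (eq_bigl (fun z : X * bool => true && (z.2 == ~~ h z.1)));
  last first.
  by move=> [x y] /=; case: y; case: (h x).
rewrite (eq_bigr (fun z => D (z.1, z.2))); last by case.
rewrite -(@pair_big_dep _ _ _ _ _ xpredT (fun x y => y == ~~ h x)
  (fun x y => D (x, y))) /=.
by apply: eq_bigr => x _; rewrite big_pred1_eq.
Qed.

Hypotheses (beta_ge0 : 0 <= beta) (beta_le1 : beta <= 1).

Lemma noisy_labelling_ge0 (c : {ffun X -> bool}) (z : X * bool) :
  0 <= noisy_labelling c z.
Proof. by rewrite ffunE divr_ge0 //; case: ifP; rewrite ?subr_ge0. Qed.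

Lemma sample_prob_ge0 (m : nat) (c : {ffun X -> bool})
    (S : {ffun 'I_m -> X * bool}) :
  0 <= sample_prob (noisy_labelling c) S.
Proof. by apply: prodr_ge0 => i _; exact: noisy_labelling_ge0. Qed.

Lemma err_noisy_labelling_ge0 (c h : {ffun X -> bool}) :
  0 <= err h (noisy_labelling c).
Proof. by apply: sumr_ge0 => z _; exact: noisy_labelling_ge0. Qed.

Lemma noisy_labelling_distribution (c : {ffun X -> bool}) :
  (0 < #|X|)%N -> is_distribution (noisy_labelling c).
Proof.
move=> X0; split; first exact: noisy_labelling_ge0.
rewrite (eq_bigr (fun z => noisy_labelling c (z.1, z.2))); last by case.
rewrite -(pair_bigA _ (fun x y => noisy_labelling c (x, y))) /=.
rewrite (eq_bigr _ (fun x _ => marginal_noisy_labelling c x)).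
by rewrite sumr_const div1r -[_^-1 *+ _]mulr_natr mulVf // pnatr_eq0 -lt0n.
Qed.

Lemma sum_sample_prob (m : nat) (D : {ffun X * bool -> R}) :
  is_distribution D -> \sum_(S : {ffun 'I_m -> X * bool}) sample_prob D S = 1.
Proof.
by case=> _ D1; rewrite -(bigA_distr_bigA (fun=> D)) big1.
Qed.

(** Pair [p] with [flip x p]: equal probability, equal output, opposite labellings at [x]. The two
    errors at [x] average to half the mass of [x]. Samples that query [x] contribute at least 0. *)
Lemma point_error_ge (m : nat) (T : {ffun 'I_m -> X} -> strategy X m) (x : X) :
  (\sum_(p : {ffun X -> bool} * {ffun 'I_m -> X * bool}
         | x \notin queried_points T p.2)
     sample_prob (noisy_labelling p.1) p.2) / (2 * #|X|%:R) <=
  \sum_(p : {ffun X -> bool} * {ffun 'I_m -> X * bool})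
     sample_prob (noisy_labelling p.1) p.2 *
     noisy_labelling p.1 (x, ~~ output (T (points p.2)) (labels p.2) x).
Proof.
set G := fun p : {ffun X -> bool} * {ffun 'I_m -> X * bool} =>
  sample_prob (noisy_labelling p.1) p.2 *
  noisy_labelling p.1 (x, ~~ output (T (points p.2)) (labels p.2) x).
have G_ge0 p : 0 <= G p.
  by rewrite mulr_ge0 ?sample_prob_ge0 ?noisy_labelling_ge0.
have G_flip p : x \notin queried_points T p.2 ->
    G p + G (flip x p) = sample_prob (noisy_labelling p.1) p.2 / #|X|%:R.
  move=> xp; rewrite /G sample_prob_flip -mulrDr /=.
  have [-> _] := flip_sample_unqueried xp.
  (* The wrong label at [x] has mass [beta / #|X|] under one labelling and [(1 - beta) / #|X|] under
     the other. *)
  congr (_ * _); rewrite !ffunE /= eqxx -mulrDl -[RHS]div1r; congr (_ / _).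
  by case: (output _ _ x); case: (p.1 x) => /=; ring.
have half : \sum_(p | x \notin queried_points T p.2)
      sample_prob (noisy_labelling p.1) p.2 / #|X|%:R =
    2 * \sum_(p | x \notin queried_points T p.2) G p.
  rewrite mulr_natl mulr2n.
  (* One of the two copies of the sum is reindexed by the flip. *)
  rewrite [in X in _ = _ + X](reindex_inj (inv_inj (flipK x))) /=.
  under [in X in _ = _ + X]eq_bigl do rewrite unqueried_flip.
  by rewrite -big_split; apply: eq_bigr => p xp; rewrite /= G_flip.
have G_le : \sum_(p | x \notin queried_points T p.2) G p <= \sum_p G p.
  by rewrite [leRHS](bigID (fun p => x \notin queried_points T p.2)) /=
    lerDl sumr_ge0.
apply: le_trans G_le.
by rewrite invfM mulrCA mulr_suml half mulKf ?pnatr_eq0.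
Qed.

(** For a fixed seed the learner is a deterministic [T]. Exchanging the sums, each pair is counted
    once per unqueried point with weight [1 / (2 * #|X|)], and over half of the points are
    unqueried. *)
Lemma sum_labellings_error_ge (m : nat)
    (T : {ffun 'I_m -> X} -> strategy X m) :
  (0 < #|X|)%N ->
  (forall S, #|queried (T (points S)) (labels S)|%:R < #|X|%:R / 2 :> R) ->
  #|{ffun X -> bool}|%:R / 4 <=
  \sum_c \sum_(S : {ffun 'I_m -> X * bool}) sample_prob (noisy_labelling c) S *
    err (output (T (points S)) (labels S)) (noisy_labelling c).
Proof.
move=> X0 fewQ; have n0 : 0 < #|X|%:R :> R by rewrite ltr0n.
rewrite pair_bigA /=.
under eq_bigr do rewrite err_sum_points mulr_sumr.
rewrite exchange_big /=.
apply: le_trans (ler_sum _ (fun x _ => point_error_ge T x)).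
rewrite -mulr_suml (exchange_big_dep xpredT) //=.
have total : \sum_(p : {ffun X -> bool} * {ffun 'I_m -> X * bool})
    sample_prob (noisy_labelling p.1) p.2 = #|{ffun X -> bool}|%:R.
  rewrite -(pair_bigA _ (fun c S => sample_prob (noisy_labelling c) S)) /=.
  under eq_bigr => c _ do
    rewrite (sum_sample_prob _ (noisy_labelling_distribution c X0)).
  by rewrite sumr_const.
rewrite ler_pdivlMr ?mulr_gt0 // -total !mulr_suml; apply: ler_sum => p _.
rewrite sumr_const -[leRHS]mulr_natr -!mulrA.
apply: ler_wpM2l; first exact: sample_prob_ge0.
have -> : #|[pred x | x \notin queried_points T p.2]| =
    #|~: queried_points T p.2|.
  by apply: eq_card => x; rewrite !inE.
(* Requested indices may share a point, so queried points are at most as many as queried indices. *)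
rewrite cardsCs finset.setCK natrB ?max_card //.
have := fewQ p.2.
have : #|queried_points T p.2|%:R <=
    #|queried (T (points p.2)) (labels p.2)|%:R :> R.
  by rewrite ler_nat leq_imset_card.
lra.
Qed.

End NoisyLabelling.

(** * Integrating over the internal randomness *)

Lemma measurable_learned (R : realType) (m : nat) (X : finType)
    (d : measure_display) (Omega : measurableType d)
    (A : active_learner Omega X m) (mA : measurable_learner A)
    (S : {ffun 'I_m -> X * bool}) (f : {ffun X -> bool} -> R) :
  measurable_fun setT (fun w => f (learned A S w)).
Proof.
(* There are finitely many hypotheses, so this is a finite combination of indicators of the events
   in [mA]. *)
rewrite (_ : (fun w => _) = fun w => \sum_h
  f h * \1_([set w | learned A S w = h]%classic) w); last first.
  apply/funext => w; rewrite (bigD1 (learned A S w)) //= big1.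
    by rewrite indicE mem_set // mulr1 addr0.
  by move=> h /eqP hw; rewrite indicE memNset ?mulr0 // => /esym.
by apply: measurable_sum => h; apply: measurable_funM.
Qed.

Theorem theorem19 (R : realType) (beta : R) (m : nat) (X : finType)
    (d : measure_display) (Omega : measurableType d) (P : probability Omega R)
    (A : active_learner Omega X m)
    (beta_ge0 : 0 <= beta) (beta_lt : beta < 1 / 2%:R)
    (m_gt0 : (0 < m)%N) (X_gt0 : (0 < #|X|)%N)
    (mA : measurable_learner A)
    (few_queries : forall (S : {ffun 'I_m -> X * bool}) (w : Omega),
       (num_queries A S w)%:R < #|X|%:R / 2%:R :> R) :
  exists D : {ffun X * bool -> R},
    [/\ is_distribution D,
        (forall x : X, marginal D x = 1 / #|X|%:R),
        (forall x : X, cond_prob_one D x = beta \/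
                       cond_prob_one D x = 1 - beta) &
        ((1 / 4%:R)%:E <= expected_err P A D)%E].
Proof.
have beta_le1 : beta <= 1 by lra.
pose D := @noisy_labelling R X beta.
suff [c Dc] : exists c, ((1 / 4%:R)%:E <= expected_err P A (D c))%E.
  exists (D c); split=> // [|x|x].
  - exact: noisy_labelling_distribution.
  - exact: marginal_noisy_labelling.
  - by rewrite cond_prob_one_noisy_labelling; case: (c x); [right|left].
pose risk c w := \sum_S sample_prob (D c) S * err (learned A S w) (D c).
have risk_ge0 c w : 0 <= risk c w.
  by apply: sumr_ge0 => S _; rewrite mulr_ge0 ?sample_prob_ge0
    ?err_noisy_labelling_ge0.
have m_err c S : measurable_fun setT (fun w => err (learned A S w) (D c)).
  exact: (measurable_learned mA S (fun h => err h (D c))).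
have m_risk c : measurable_fun setT (risk c).
  by apply: measurable_sum => S; apply: measurable_funM.
have riskE c : expected_err P A (D c) = (\int[P]_w (risk c w)%:E)%E.
  under eq_integral do rewrite /risk -sumEFin.
  rewrite ge0_integral_sum //=; last 2 first.
  - by move=> S; apply/measurable_EFinP; apply: measurable_funM.
  - by move=> S w _; rewrite lee_fin mulr_ge0 ?sample_prob_ge0
      ?err_noisy_labelling_ge0.
  apply: eq_bigr => S _; rewrite unlock -ge0_integralZl_EFin //.
  - by move=> w _; rewrite lee_fin err_noisy_labelling_ge0.
  - exact/measurable_EFinP.
  - exact: sample_prob_ge0.
(* The bound holds for every seed, so it survives integration against the probability [P]. *)
have avg : ((#|{ffun X -> bool}|%:R / 4)%:E <=
    \sum_c expected_err P A (D c))%E.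
  under eq_bigr do rewrite riskE.
  rewrite -ge0_integral_sum //=; last 2 first.
  - by move=> c; apply/measurable_EFinP.
  - by move=> c w _; rewrite lee_fin.
  rewrite -(expectation_cst P) unlock; apply: ge0_le_integral => //=.
    by apply: emeasurable_sum => c; apply/measurable_EFinP.
  move=> w _; rewrite sumEFin lee_fin.
  by apply: sum_labellings_error_ge => // S; exact: few_queries.
apply: contrapT => small.
have lt14 c : (expected_err P A (D c) < (1 / 4%:R)%:E)%E.
  by rewrite ltNge; apply/negP => Dc; apply: small; exists c.
(* Being nonnegative and below 1/4, the expectations are finite, and the sums can be compared in
   [R]. *)
have fin c : expected_err P A (D c) = (fine (expected_err P A (D c)))%:E.
  rewrite fineK // ge0_fin_numE ?(lt_trans (lt14 c)) ?ltry //.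
  by rewrite riskE integral_ge0 // => w _; rewrite lee_fin.
have := avg; rewrite (eq_bigr _ (fun c _ => fin c)).
rewrite sumEFin lee_fin leNgt => /negP; apply.
apply: (@lt_le_trans _ _ (\sum_(c : {ffun X -> bool}) 1 / 4%:R)).
  apply: ltr_sum => [|c _]; last by rewrite -lte_fin -fin.
  (* Strict inequality of the sums needs at least one labelling. *)
  by apply/hasP; exists [ffun=> true]; rewrite ?mem_index_enum.
by rewrite sumr_const div1r -[leLHS]mulr_natl.
Qed.
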